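(* Let $0<\alpha<\infty$, $0\le g\in L_1[0,\alpha)$, and $k\in\mathbb{N}$. For $0\le f\in L_1[0,\alpha)$, $f$ is a $k$-extreme point of $\Omega'(g)$ if and only if $\mu(f)$ is a $k$-extreme point of $\Omega'(g)$. Moreover, the set of all $k$-extreme points of $\Omega'(g)$ is $$\{0\le f\in L_1[0,\alpha):\ \mu(f)=\mu(g)\}.$$
   Context: Let $m$ be Lebesgue measure; functions are taken mod a.e. equality. For measurable $f$ on $[0,\alpha)$, $d(\lambda,f)=m\{t:|f(t)|>\lambda\}$ and $\mu(t,f)=\inf\{s>0:d(s,f)\le t\}$, $t\ge0$, is its decreasing rearrangement; $\mu(t,f)=0$ for $t\ge\alpha$, and $\mu(f)$ is identified with its restriction to $[0,\alpha)$. Write $f\prec g$ if $\int_0^t\mu(f)\le\int_0^t\mu(g)$ for all $t>0$. The orbit $\Omega'(g)$ is $$\Omega'(g)=\{0\le f\in L_1[0,\alpha):\ f\prec g\ \text{and}\ \|f\|_1=\|g\|_1\}.$$ A point $f\in\Omega'(g)$ is a $k$-extreme point of $\Omega'(g)$ if whenever $f=\frac1{k+1}\sum_{i=1}^{k+1}f_i$ with all $f_i\in\Omega'(g)$, the functions $f_1,\dots,f_{k+1}$ are linearly dependent. *)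

(* Defs.v *)
From mathcomp Require Import all_boot all_order all_algebra.
From mathcomp Require Import all_classical all_reals all_analysis.

Set Implicit Arguments.
Unset Strict Implicit.
Unset Printing Implicit Defensive.

Import Order.TTheory GRing.Theory Num.Theory.
Import numFieldNormedType.Exports.

Local Open Scope classical_set_scope.
Local Open Scope ring_scope.

(* A function on [0, a) modulo a.e. equality is given by a representative
   R -> R. Only the restriction of the representative to `[0, a[ matters, and
   equalities and signs are required almost everywhere on `[0, a[. *)

Definition ae_eq_on {R : realType} (a : R) (f g : R -> R) : Prop :=
  f = g %[ae (@lebesgue_measure R) in `[0, a[%classic].

Definition L1_on {R : realType} (a : R) (f : R -> R) : Prop :=
  (@lebesgue_measure R).-integrable `[0, a[ (EFin \o f).

Definition ae_nonneg_on {R : realType} (a : R) (f : R -> R) : Prop :=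
  {ae (@lebesgue_measure R), forall x, `[0, a[%classic x -> 0 <= f x}.

Definition L1_pos {R : realType} (a : R) : set (R -> R) :=
  [set f | L1_on a f /\ ae_nonneg_on a f].

Definition L1_norm {R : realType} (a : R) (f : R -> R) : \bar R :=
  (\int[@lebesgue_measure R]_(x in `[0%R, a[) `|f x|%:E)%E.

Definition distribution_function {R : realType} (a s : R) (f : R -> R) : \bar R :=
  (@lebesgue_measure R) [set t | `[0, a[%classic t /\ s < `|f t|].

(* Extended-real valued, since the value at t = 0 is +oo when f is essentially
   unbounded. *)
Definition rearrangement {R : realType} (a : R) (f : R -> R) (t : R) : \bar R :=
  ereal_inf [set s%:E |
    s in [set s : R | 0 < s /\ (distribution_function a s f <= t%:E)%E]].

(* For f in L_1[0, a), [fine] changes the rearrangement on [0, a) at most at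
   the single point t = 0. *)
Definition mu_fun {R : realType} (a : R) (f : R -> R) : R -> R :=
  fun t => fine (rearrangement a f t).

Definition submajorized {R : realType} (a : R) (f g : R -> R) : Prop :=
  forall t : R, 0 < t ->
    (\int[@lebesgue_measure R]_(x in `[0%R, t[) rearrangement a f x <=
     \int[@lebesgue_measure R]_(x in `[0%R, t[) rearrangement a g x)%E.

Definition orbit' {R : realType} (a : R) (g : R -> R) : set (R -> R) :=
  [set f | [/\ L1_pos a f, submajorized a f g & L1_norm a f = L1_norm a g]].

Definition linearly_dependent_on {R : realType} (a : R) (n : nat)
    (F : 'I_n -> R -> R) : Prop :=
  exists c : 'I_n -> R,
    (exists i, c i != 0) /\
    ae_eq_on a (fun x => \sum_(i < n) c i * F i x) (fun=> 0).

Definition k_extreme {R : realType} (a : R) (k : nat) (A : set (R -> R))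
    (f : R -> R) : Prop :=
  A f /\
  forall F : 'I_k.+1 -> R -> R, (forall i, A (F i)) ->
    ae_eq_on a f (fun x => k.+1%:R^-1 * \sum_(i < k.+1) F i x) ->
    linearly_dependent_on a F.

(* Main.v *)
Require Import Defs.
From mathcomp Require Import all_boot all_order all_algebra.
From mathcomp Require Import all_classical all_reals all_analysis.
From mathcomp Require Import measurable_realfun.
From mathcomp Require Import lra.

Set Implicit Arguments.
Unset Strict Implicit.
Unset Printing Implicit Defensive.

Import Order.TTheory GRing.Theory Num.Theory.
Import numFieldNormedType.Exports.

Local Open Scope classical_set_scope.
Local Open Scope ring_scope.

(** Everything is read off the excess function
    [excess f s], the integral over [0, a) of the positive part of |f| - s,
    for s >= 0.  It is a convex nonincreasing function of s with right slope
    minus the distribution function of f, so it determines the rearrangement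
    of f and is determined by it.

    By the layer-cake formula the excess is the same for f and for its
    rearrangement, and cutting the rearrangement at height s shows that the
    integral of the rearrangement over [0, t) is the minimum over s >= 0 of
    [excess f s + s * t].  Hence f is submajorized by g if and only if
    excess f <= excess g pointwise ([submajorizedP]); the norm is the excess
    at 0, so the orbit of g consists of the nonnegative f with
    excess f <= excess g and equality at 0 ([orbitP]).  The claim becomes: the
    k-extreme points are the nonnegative f with excess f = excess g.

    If excess f = excess g and f is the average of points F i of the orbit,
    then for each s the convex function v |-> (v - s)^+ satisfies Jensen's
    inequality at f with equality almost everywhere, since the integrals of
    the two sides are already ordered the other way.  Applied to all rational
    s at once this forces all F i to coincide almost everywhere
    ([average_ae_const]); as there are at least two of them, they are linearly
    dependent.

    If excess f < excess g somewhere, then the strict inequality holds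
    throughout some window around a level c > 0 such that |f| is close to c on
    a set of positive measure: otherwise excess f would be affine around a
    point where the difference of the two excesses, slightly bent upwards,
    is maximal, against the convexity of excess g ([exists_slack_level]).
    Perturbing f by small functions of integral zero supported where |f| is
    near c changes the excess only at levels where there is slack, so it
    stays in the orbit ([excess_perturbation]).  Splitting that set into k + 1
    pieces of equal measure provides k + 1 such perturbations with sum zero for
    which the perturbed functions are linearly independent
    ([not_k_extreme]).

    Finally, the characterization only involves the rearrangement, and the
    rearrangement of a rearrangement is itself, which gives the equivalence
    between f and its rearrangement. *)

(** * Layer cake *)

Local Notation leb R := (@lebesgue_measure R).

(** Both sides measure the region between 0 and the graph of [f] over [D];
    Tonelli's theorem slices it in the two directions. *)
Lemma layer_cake (R : realType) (D : set R) (f : R -> R) :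
  measurable D -> measurable_fun D f ->
  (\int[leb R]_(x in D) (Num.max (f x) 0)%:E =
   \int[leb R]_u
     (if (0 <= u)%R then leb R [set x | D x /\ (u < f x)%R] else 0))%E.
Proof.
move=> mD mf.
pose h := f \_ D.
have mh : measurable_fun setT h by exact: (measurable_restrictT f mD).1 mf.
pose A := [set p : R * R | 0 <= p.2 < h p.1].
have mA : measurable A.
  have -> : A = (fun p : R * R => (0 <= p.2) && (p.2 < h p.1)) @^-1` [set true].
    by apply/seteqP; split => p /=.
  rewrite -[X in measurable X]setTI.
  suff mb : measurable_fun setT (fun p : R * R => (0 <= p.2) && (p.2 < h p.1)).
    exact: mb.
  apply: measurable_and.
    exact: measurable_fun_ler.
  apply: measurable_fun_ltr => //.
  exact: (measurableT_comp mh).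
transitivity (\int[leb R]_x leb R (xsection A x))%E; last first.
  transitivity (\int[leb R]_u leb R (ysection A u))%E.
    exact: (etrans (esym (congr1 _ (indic_fubini_tonelli_FE (leb R) mA)))
      (etrans (indic_fubini_tonelli (leb R) (leb R) mA)
        (congr1 _ (indic_fubini_tonelli_GE (leb R) mA)))).
  apply: eq_integral => u _ /=.
  case: ifPn => u0; last first.
    rewrite (_ : ysection A u = set0) ?measure0//.
    by apply/seteqP; split => x //=; rewrite /ysection/= inE /A /= (negbTE u0).
  congr (leb R _); apply/seteqP; split => x /=;
    rewrite /ysection/= inE /A /= u0 /= /h patchE.
    by case: ifPn => [/set_mem //|_]; rewrite ltNge u0.
  by move=> [Dx ux]; rewrite mem_set.
rewrite integral_mkcond; apply: eq_integral => x _ /=.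
have -> : xsection A x = `[0, h x[%classic.
  by apply/seteqP; split => u /=; rewrite /xsection /= ?in_itv /= inE /A /=.
rewrite lebesgue_measure_itv /= lte_fin /h !patchE.
case: ifPn => xD; last by rewrite ltxx.
by rewrite oppr0 adde0; case: leP.
Qed.

Lemma eq_integral_pospart (R : realType) (D D' : set R) (f f' : R -> R) :
  measurable D -> measurable_fun D f -> measurable D' -> measurable_fun D' f' ->
  (forall u, 0 <= u -> leb R [set x | D x /\ u < f x] =
                       leb R [set x | D' x /\ u < f' x]) ->
  (\int[leb R]_(x in D) (Num.max (f x) 0)%:E =
   \int[leb R]_(x in D') (Num.max (f' x) 0)%:E)%E.
Proof.
move=> mD mf mD' mf' dE; rewrite !layer_cake//; apply: eq_integral => u _.
by case: ifPn => // /dE.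
Qed.

(** * Almost everywhere statements *)

Section almost_everywhere.
Context {R : realType}.
Local Notation mu := (@lebesgue_measure R).

Lemma ae_mono (P Q : R -> Prop) : (forall x, P x -> Q x) ->
  {ae mu, forall x, P x} -> {ae mu, forall x, Q x}.
Proof. by apply: (@filterS _ _ (ae_filter_ringOfSetsType mu)). Qed.

Lemma ae_mono2 (P P' Q : R -> Prop) : (forall x, P x -> P' x -> Q x) ->
  {ae mu, forall x, P x} -> {ae mu, forall x, P' x} -> {ae mu, forall x, Q x}.
Proof. by apply: (@filterS2 _ _ (ae_filter_ringOfSetsType mu)). Qed.

Lemma ae_forall_countType (I : countType) (P : I -> R -> Prop) :
  (forall i, {ae mu, forall x, P i x}) -> {ae mu, forall x, forall i, P i x}.
Proof.
move=> H.
have G : {ae mu, forall x, forall n i, @unpickle I n = Some i -> P i x}.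
  apply: (@ae_foralln _ _ _ mu
    (fun n x => forall i, unpickle n = Some i -> P i x)) => n.
  case E : (@unpickle I n) => [i|]; last exact: aeW.
  by apply: ae_mono (H i) => x Px j [<-].
by apply: ae_mono G => x Gx i; apply: (Gx (pickle i)); rewrite pickleK.
Qed.

End almost_everywhere.

(** * Distribution function and decreasing rearrangement *)

Section rearrangement.
Context {R : realType}.
Variable a : R.
Hypothesis a0 : 0 < a.
Implicit Types (f g : R -> R) (s t : R).
Local Notation mu := (@lebesgue_measure R).
Local Notation D := (`[0, a[%classic : set R).
Local Notation dist f s := (distribution_function a s f).

Lemma measure_domain : mu D = a%:E.
Proof. by rewrite lebesgue_measure_itv /= lte_fin a0 oppr0 adde0. Qed.

Lemma distribution_ge0 f s : (0 <= dist f s)%E. Proof. exact: measure_ge0. Qed.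

Lemma measurable_L1 f : L1_on a f -> measurable_fun D f.
Proof. by move=> /measurable_int /measurable_EFinP. Qed.

Lemma measurable_level f s : measurable_fun D f ->
  measurable [set t | D t /\ s < `|f t|].
Proof.
move=> mf.
have mnf : measurable_fun D (fun x => `|f x|) by exact: measurableT_comp.
have -> : [set t | D t /\ s < `|f t|] = D `&` (fun x => `|f x|) @^-1` `]s, +oo[.
  by apply/seteqP; split => x /=; rewrite !in_itv /= andbT.
exact: mnf (measurable_itv _) _ (measurable_itv _).
Qed.

Lemma distribution_nonincreasing f s t : measurable_fun D f -> s <= t ->
  (dist f t <= dist f s)%E.
Proof.
move=> mf st; apply: le_measure; rewrite ?inE; try exact: measurable_level.
by move=> x [Dx /(le_lt_trans st)].
Qed.

Lemma distribution_le_length f s : measurable_fun D f -> (dist f s <= a%:E)%E.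
Proof.
move=> mf; rewrite -measure_domain; apply: le_measure; rewrite ?inE;
  [exact: measurable_level|exact: measurable_itv|by move=> x []].
Qed.

Lemma distribution_fin_num f s : measurable_fun D f -> dist f s \is a fin_num.
Proof.
move=> mf; rewrite ge0_fin_numE ?distribution_ge0//.
exact: le_lt_trans (distribution_le_length s mf) (ltry _).
Qed.

Lemma distribution_right_continuous f s (y : \bar R) : measurable_fun D f ->
  (forall e : R, 0 < e -> (dist f (s + e) <= y)%E) -> (dist f s <= y)%E.
Proof.
move=> mf H.
pose F n := [set t | D t /\ s + n.+1%:R^-1 < `|f t|].
have FE : \bigcup_n F n = [set t | D t /\ s < `|f t|].
  apply/seteqP; split => x /=.
    move=> [n _ [Dx]] /(le_lt_trans _) sx; split => //; apply: sx.
    by rewrite lerDl.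
  move=> [Dx sx]; have /ltr_add_invr[n nx] := sx.
  by exists n.
have mF n : measurable (F n) by exact: measurable_level.
have := @nondecreasing_cvg_mu _ _ R mu F mF.
rewrite FE => /(_ (measurable_level s mf)) cvgF.
have ndF : nondecreasing_seq F.
  apply/nondecreasing_seqP => n; apply/subsetPset => x [Dx] /(le_lt_trans _) sx.
  by split => //; apply: sx; rewrite lerD2l lef_pV2 ?posrE// ler_nat.
have {cvgF ndF} cF := cvgF ndF.
rewrite /distribution_function -(cvg_lim _ cF)//.
apply: lime_le; first by apply/cvg_ex; exists (mu [set t | D t /\ s < `|f t|]).
by apply: nearW => n /=; apply: H.
Qed.

Lemma rearrangement_ge0 f t : (0 <= rearrangement a f t)%E.
Proof.
by apply: le_ereal_inf_tmp => _ [s [s0 _] <-]; rewrite lee_fin ltW.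
Qed.

(** The rearrangement is the generalized inverse of the distribution function.
    Right continuity makes the inequalities strict on both sides, so this
    holds for all t, negative t included, and it replaces the
    definition of the rearrangement as an infimum everywhere below. *)
Lemma gt_rearrangement f s t : measurable_fun D f -> 0 <= s ->
  (s%:E < rearrangement a f t)%E = (t%:E < dist f s)%E.
Proof.
move=> mf s0; apply/idP/idP; rewrite !ltNge; apply: contra => H.
  apply/lee_addgt0Pr => e e0; apply: ereal_inf_lbound; exists (s + e) => //=.
  split; first by rewrite ltr_wpDl.
  apply: le_trans H; apply: distribution_nonincreasing => //.
  by rewrite lerDl ltW.
apply: distribution_right_continuous => // e e0.
have /ereal_inf_lt[_ [s' [s'0 ds'] <-]] : (rearrangement a f t < (s + e)%:E)%E.
  by rewrite (le_lt_trans H)// lte_fin ltrDl.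
rewrite lte_fin => /ltW s'e.
by apply: le_trans ds'; apply: distribution_nonincreasing.
Qed.

End rearrangement.

(** * Integrals of the rearrangement *)

Section rearrangement_integrals.
Context {R : realType}.
Variable a : R.
Hypothesis a0 : 0 < a.
Implicit Types (f g : R -> R) (s t : R).
Local Notation mu := (@lebesgue_measure R).
Local Notation D := (`[0, a[%classic : set R).
Local Notation dist f s := (distribution_function a s f).

(** An infinite value at t > 0 would mean that all level sets have measure
    above t, against Markov's inequality. *)
Lemma rearrangement_fin_num f t : L1_on a f -> 0 < t ->
  rearrangement a f t \is a fin_num.
Proof.
move=> f1 t0; have mf := measurable_L1 f1.
rewrite ge0_fin_numE ?rearrangement_ge0// ltNge.
apply/negP => /(lt_le_trans _) oot.
have /integrableP[mEf foo] := f1.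
set C := (\int[mu]_(x in D) `|(EFin \o f) x|)%E in foo.
have C0 : (0 <= C)%E by apply: integral_ge0.
have CE : C = (fine C)%:E by rewrite fineK// ge0_fin_numE.
have c0 : 0 <= fine C by rewrite fine_ge0.
(* a level with s * t larger than the integral C of |f| *)
pose s := fine C / t + 1.
have s0 : 0 < s by rewrite ltr_wpDl// divr_ge0// ltW.
have ts : (t%:E < dist f s)%E.
  by rewrite -gt_rearrangement ?ltW// oot// ltry.
have : (s%:E * dist f s <= C)%E.
  apply: le_trans (le_integral_abse mu (measurable_itv _) mEf s0).
  rewrite lee_pmul2l//.
  apply: le_measure; rewrite ?inE; first exact: measurable_level.
    by apply: emeasurable_fun_c_infty => //; exact: measurableT_comp.
  by move=> x [Dx sx]; split => //=; rewrite lee_fin ltW.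
apply/negP; rewrite -ltNge CE.
rewrite (@lt_trans _ _ (s%:E * t%:E)%E)//; last by rewrite lte_pmul2l.
by rewrite -EFinM lte_fin mulrDl mulfVK ?gt_eqF// mul1r ltrDl.
Qed.

Lemma mu_funE f t : L1_on a f -> 0 < t ->
  (mu_fun a f t)%:E = rearrangement a f t.
Proof. by move=> f1 t0; rewrite /mu_fun fineK// rearrangement_fin_num. Qed.

Lemma mu_fun_ge0 f t : 0 <= mu_fun a f t.
Proof. by rewrite /mu_fun fine_ge0// rearrangement_ge0. Qed.

Lemma gt_mu_fun f s t : L1_on a f -> 0 <= s -> 0 < t ->
  (s < mu_fun a f t) = (t%:E < dist f s)%E.
Proof.
move=> f1 s0 t0; have mf := measurable_L1 f1.
by rewrite -lte_fin mu_funE// gt_rearrangement.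
Qed.

Lemma mu_fun_le f t t' : L1_on a f -> 0 < t -> t <= t' ->
  mu_fun a f t' <= mu_fun a f t.
Proof.
move=> f1 t0 tt'; rewrite leNgt gt_mu_fun ?mu_fun_ge0//;
  last exact: lt_le_trans tt'.
rewrite -leNgt.
apply: (@le_trans _ _ t%:E); last by rewrite lee_fin.
by rewrite leNgt -gt_mu_fun ?mu_fun_ge0// ltxx.
Qed.

Lemma level_mu_fun f s : L1_on a f -> 0 <= s ->
  [set t | `]0, +oo[%classic t /\ s < mu_fun a f t] =
  `]0, fine (dist f s)[%classic.
Proof.
move=> f1 s0; have mf := measurable_L1 f1.
apply/seteqP; split => t /=; rewrite !in_itv /= ?andbT.
  by move=> [t0]; rewrite gt_mu_fun// t0 -lte_fin fineK// distribution_fin_num.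
move=> /andP[t0]; rewrite -lte_fin fineK ?distribution_fin_num// => td.
split => //.
by rewrite gt_mu_fun.
Qed.

Lemma measurable_mu_fun f : L1_on a f ->
  measurable_fun (`]0, +oo[%classic : set R) (mu_fun a f).
Proof.
move=> f1 _; apply: (measurability _ (RGenOInfty.measurableE R)) => //.
move=> _ [_ [r ->] <-].
have [r0|r0] := leP 0 r.
  rewrite (_ : _ `&` _ = `]0, fine (dist f r)[%classic) ?level_mu_fun//.
  rewrite -level_mu_fun//; apply/seteqP; split => x /=;
    by rewrite !in_itv /= !andbT.
rewrite (_ : _ `&` _ = `]0, +oo[%classic)//.
apply/seteqP; split => x /=; first by case.
move=> x0; split => //; rewrite in_itv /= andbT.
exact: lt_le_trans (mu_fun_ge0 f x).
Qed.

Lemma measure_level_mu_fun f s : L1_on a f -> 0 <= s ->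
  mu [set t | `]0, +oo[%classic t /\ s < mu_fun a f t] = dist f s.
Proof.
move=> f1 s0; have mf := measurable_L1 f1.
rewrite level_mu_fun// lebesgue_measure_itv /= lte_fin.
rewrite -[RHS]fineK ?distribution_fin_num//.
rewrite oppr0 adde0; case: ltP => // d0.
by apply/eqP; rewrite eqe eq_le d0 fine_ge0 ?distribution_ge0.
Qed.

(** As a function of [s], this is the stop-loss transform of |f|; the
    absolute value matches the one in the distribution function. *)
Definition excess f s : R := \int[mu]_(x in D) Num.max (`|f x| - s) 0.

Lemma L1_on_cst (r : R) : L1_on a (fun=> r).
Proof.
have D_lty : (mu D < +oo)%E by rewrite measure_domain// ltry.
by apply: measurable_bounded_integrable => //; exact: bounded_cst.
Qed.

Lemma L1_onD f g : L1_on a f -> L1_on a g -> L1_on a (fun x => f x + g x).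
Proof. by move=> f1 g1; exact: (integrableD _ f1 g1). Qed.

Lemma L1_onB f g : L1_on a f -> L1_on a g -> L1_on a (fun x => f x - g x).
Proof. by move=> f1 g1; exact: (integrableB _ f1 g1). Qed.

Lemma L1_onZ (r : R) f : L1_on a f -> L1_on a (fun x => r * f x).
Proof. by move=> f1; exact: (integrableZl _ r f1). Qed.

Lemma L1_on_norm f : L1_on a f -> L1_on a (fun x => `|f x|).
Proof. exact: integrable_norm. Qed.

Lemma L1_on_sum n (F : 'I_n -> R -> R) : (forall i, L1_on a (F i)) ->
  L1_on a (fun x => \sum_(i < n) F i x).
Proof.
elim: n F => [|n IH] F F1.
  rewrite (_ : (fun _ => _) = fun=> 0); first exact: L1_on_cst.
  by apply/funext => x; rewrite big_ord0.
rewrite (_ : (fun _ => _) = fun x => F ord0 x + \sum_(i < n) F (lift ord0 i) x).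
  by apply: L1_onD => //; exact: IH.
by apply/funext => x; rewrite big_ord_recl.
Qed.

Lemma L1_on_indic (A : set R) : measurable A -> L1_on a (\1_A : R -> R).
Proof.
move=> mA; apply: le_integrable (L1_on_cst 1) => //.
  by apply/measurable_EFinP; exact: measurable_funTS.
by move=> x _ /=; rewrite lee_fin normr1 indicE; case: (_ \in _);
  rewrite ?normr0 ?normr1.
Qed.

Lemma Rintegral_indic_D (A : set R) : measurable A -> A `<=` D ->
  \int[mu]_(x in D) \1_A x = fine (mu A).
Proof.
by move=> mA AD; rewrite /Rintegral integral_indic// setIidl.
Qed.

Lemma L1_on_pospart f s : L1_on a f ->
  L1_on a (fun x => Num.max (`|f x| - s) 0).
Proof.
move=> f1; have mf := measurable_L1 f1.
have gs := L1_onD (L1_on_norm f1) (L1_on_cst `|s|).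
apply: le_integrable gs => //.
  apply/measurable_EFinP; apply: measurable_maxr => //.
  by apply: measurable_funB => //; exact: measurableT_comp.
move=> x _ /=; rewrite lee_fin.
rewrite [leRHS]ger0_norm ?addr_ge0// ger0_norm ?le_max ?lexx ?orbT//.
rewrite ge_max addr_ge0// andbT lerD2l.
by rewrite -normrN ler_norm.
Qed.

Lemma excessE f s : L1_on a f ->
  (excess f s)%:E = (\int[mu]_(x in D) (Num.max (`|f x| - s) 0)%:E)%E.
Proof.
move=> f1; rewrite /excess /Rintegral fineK// integrable_fin_num//.
exact: L1_on_pospart.
Qed.

(** The rearrangement has the same level sets as [f] in measure. The point 0 is
    left out of the domain, because the rearrangement of an essentially
    unbounded [f] is infinite there and [mu_fun] then returns 0. *)
Lemma excess_mu_fun f s : L1_on a f -> 0 <= s ->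
  (excess f s)%:E =
  (\int[mu]_(x in `]0%R, +oo[) (Num.max (mu_fun a f x - s) 0)%:E)%E.
Proof.
move=> f1 s0; have mf := measurable_L1 f1; rewrite excessE//.
apply: eq_integral_pospart => //.
- by apply: measurable_funB => //; exact: measurableT_comp.
- by apply: measurable_funB => //; exact: measurable_mu_fun.
move=> u u0; transitivity (dist f (u + s)).
  by congr (mu _); apply/seteqP; split => x /=; rewrite ltrBrDr.
rewrite -measure_level_mu_fun// ?addr_ge0//.
by congr (mu _); apply/seteqP; split => x /=; rewrite ltrBrDr.
Qed.

Lemma excess_ge0 f s : 0 <= excess f s.
Proof. by apply: Rintegral_ge0 => x _; rewrite le_max lexx orbT. Qed.

Lemma integral_rearrangement f t : L1_on a f -> 0 < t ->
  (\int[mu]_(x in `[0%R, t[) rearrangement a f x =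
   \int[mu]_(x in `]0%R, t[) (mu_fun a f x)%:E)%E.
Proof.
move=> f1 t0.
have E x : x \in (`]0%R, t[%classic : set R) ->
    rearrangement a f x = (mu_fun a f x)%:E.
  by rewrite inE /= in_itv /= => /andP[x0 _]; rewrite mu_funE.
rewrite -integral_itv_obnd_cbnd; first exact: eq_integral.
apply: (eq_measurable_fun (EFin \o mu_fun a f)) => [x /E//|].
apply/measurable_EFinP; apply: measurable_funS (measurable_mu_fun f1) => //.
by move=> x /=; rewrite !in_itv /= andbT => /andP[].
Qed.

(** A section-local fact, so that [//] closes the inclusions below with it. *)
Let subset_itv_pos t : `]0%R, t[%classic `<=` (`]0%R, +oo[%classic : set R).
Proof. by move=> x /=; rewrite !in_itv /= andbT => /andP[]. Qed.

Let measurable_mu_fun_pos f s :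
  L1_on a f -> measurable_fun (`]0, +oo[%classic : set R)
    (fun x => (Num.max (mu_fun a f x - s) 0)%:E).
Proof.
move=> f1; apply/measurable_EFinP; apply: measurable_maxr => //.
by apply: measurable_funB => //; exact: measurable_mu_fun.
Qed.

Let integral_pospart_cst f s t : L1_on a f -> 0 < t -> 0 <= s ->
  (\int[mu]_(x in `]0%R, t[) ((Num.max (mu_fun a f x - s) 0)%:E + s%:E) =
   \int[mu]_(x in `]0%R, t[) (Num.max (mu_fun a f x - s) 0)%:E + (s * t)%:E)%E.
Proof.
move=> f1 t0 s0; rewrite ge0_integralD//.
- have m0t : mu `]0, t[%classic = t%:E.
    by rewrite lebesgue_measure_itv /= lte_fin t0 oppr0 adde0.
  by rewrite integral_cst// EFinM; congr (_ + _ * _)%E.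
- by move=> x _; rewrite lee_fin le_max lexx orbT.
- apply: measurable_funS (measurable_mu_fun_pos s f1) => //.
Qed.

(** One half of the duality between the integrals of the rearrangement and
    the excess: bound the rearrangement by s plus its part above s. *)
Lemma le_integral_rearrangement f s t : L1_on a f -> 0 < t -> 0 <= s ->
  (\int[mu]_(x in `[0%R, t[) rearrangement a f x <= (excess f s + s * t)%:E)%E.
Proof.
move=> f1 t0 s0; rewrite integral_rearrangement// EFinD.
apply: (@le_trans _ _ (\int[mu]_(x in `]0%R, t[)
    ((Num.max (mu_fun a f x - s) 0)%:E + s%:E))%E).
  apply: ge0_le_integral => //.
  - by move=> x _; rewrite lee_fin mu_fun_ge0.
  - apply/measurable_EFinP; exact: measurable_funS (measurable_mu_fun f1).
  - apply: emeasurable_funD => //.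
    exact: measurable_funS (measurable_mu_fun_pos s f1).
  - by move=> x _; rewrite -EFinD lee_fin -lerBlDr le_max lexx.
rewrite integral_pospart_cst// leeD2r// excess_mu_fun//.
apply: ge0_subset_integral => //; first exact: measurable_mu_fun_pos.
by move=> x _; rewrite lee_fin le_max lexx orbT.
Qed.

(** The bound is attained when the rearrangement crosses the height s
    at time t. *)
Lemma eq_integral_rearrangement f s t : L1_on a f -> 0 < t -> 0 <= s ->
  (forall x, 0 < x -> x < t -> s <= mu_fun a f x) ->
  (forall x, t <= x -> mu_fun a f x <= s) ->
  (\int[mu]_(x in `[0%R, t[) rearrangement a f x = (excess f s + s * t)%:E)%E.
Proof.
move=> f1 t0 s0 fl fr; rewrite integral_rearrangement// EFinD.
transitivity (\int[mu]_(x in `]0%R, t[)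
    ((Num.max (mu_fun a f x - s) 0)%:E + s%:E))%E.
  apply: eq_integral => x; rewrite inE /= in_itv /= => /andP[x0 xt].
  by rewrite -EFinD max_l ?subr_ge0 ?fl// subrK.
rewrite integral_pospart_cst//; congr (_ + _)%E; rewrite excess_mu_fun//.
rewrite [LHS]integral_mkcond [RHS]integral_mkcond; apply: eq_integral => x _.
rewrite !patchE !mem_setE !in_itv /= andbT.
case: ltP => //= x0; case: ltP => //= tx.
by rewrite max_r// subr_le0 fr.
Qed.

(** Given s, the bound for [f] is attained at t = measure of the set where
    |f| > s; given t, the bound for [g] is attained at s = rearrangement of
    [g] at t. The other function only enters through the inequality. *)
Lemma submajorizedP f g : L1_on a f -> L1_on a g ->
  submajorized a f g <-> (forall s, 0 <= s -> excess f s <= excess g s).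
Proof.
move=> f1 g1; have mf := measurable_L1 f1; split => [fg s s0|fg t t0].
  pose t := fine (dist f s).
  have tE : t%:E = dist f s by rewrite fineK// distribution_fin_num.
  have : 0 <= t by rewrite fine_ge0// distribution_ge0.
  rewrite le_eqVlt => /predU1P[t0|t0].
    rewrite (_ : excess f s = 0) ?excess_ge0//.
    apply: EFin_inj; rewrite excess_mu_fun//; apply: integral0_eq => x /=.
    rewrite in_itv /= andbT => x0; rewrite max_r// subr_le0 leNgt gt_mu_fun//.
    by rewrite -tE -t0 lte_fin -leNgt ltW.
  have := le_trans (fg t t0) (le_integral_rearrangement g1 t0 s0).
  rewrite (@eq_integral_rearrangement f s t)// ?lee_fin ?lerD2r// => x.
    by move=> x0 xt; rewrite ltW// gt_mu_fun// -tE lte_fin.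
  by move=> tx; rewrite leNgt gt_mu_fun// ?(lt_le_trans t0)//
    -tE lte_fin -leNgt.
pose s := mu_fun a g t; have s0 : 0 <= s by exact: mu_fun_ge0.
rewrite (@eq_integral_rearrangement g s t)//.
- apply: le_trans (le_integral_rearrangement f1 t0 s0) _.
  by rewrite lee_fin lerD2r fg.
- by move=> x x0 xt; apply: mu_fun_le => //; exact: ltW.
- by move=> x tx; apply: mu_fun_le.
Qed.

Lemma L1_normE f : L1_on a f -> L1_norm a f = (excess f 0)%:E.
Proof.
move=> f1; rewrite excessE//; apply: eq_integral => x _.
by rewrite subr0 max_l.
Qed.

End rearrangement_integrals.

(** * The excess determines the rearrangement *)

Section orbit.
Context {R : realType}.
Variable a : R.
Hypothesis a0 : 0 < a.
Implicit Types (f g : R -> R) (s t r e u : R).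
Local Notation mu := (@lebesgue_measure R).
Local Notation D := (`[0, a[%classic : set R).
Local Notation dist f s := (distribution_function a s f).

(** Raising the truncation level from s to s + e costs between 0 and e at
    each point, exactly 0 where |f| <= s and exactly e where |f| > s + e. *)
Lemma excess_slope f s e : L1_on a f -> 0 < e ->
  e * fine (dist f (s + e)) <= excess a f s - excess a f (s + e)
                            <= e * fine (dist f s).
Proof.
move=> f1 e0; have mf := measurable_L1 f1.
have mL (r : R) : measurable [set t | D t /\ r < `|f t|].
  by exact: measurable_level.
have IL (r : R) : e * fine (dist f r) =
    \int[mu]_(x in D) (e * \1_[set t | D t /\ r < `|f t|] x).
  rewrite RintegralZl ?Rintegral_indic_D//; first by move=> x [].
  exact: L1_on_indic.
have iL (r : R) : L1_on a (fun x => e * \1_[set t | D t /\ r < `|f t|] x).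
  by apply: L1_onZ; exact: L1_on_indic.
rewrite !IL -RintegralB//; try exact: L1_on_pospart.
have iB := L1_onB (L1_on_pospart a0 s f1) (L1_on_pospart a0 (s + e) f1).
apply/andP; split; (apply: le_Rintegral => //;
  [exact: iL || exact: iB..|move=> x Dx; rewrite indicE]).
  have [|] := boolP (x \in _); rewrite ?inE ?notin_setE /=.
    by move=> [_ H]; rewrite !max_l; lra.
  rewrite mulr0 subr_ge0 => _; rewrite ge_max !le_max lexx orbT andbT.
  by apply/orP; left; lra.
have [|] := boolP (x \in _); rewrite ?inE ?notin_setE /=.
  move=> [_ H]; rewrite [X in X - _]max_l; last lra.
  have : `|f x| - (s + e) <= Num.max (`|f x| - (s + e)) 0.
    by rewrite le_max lexx.
  lra.
by move=> /not_andP[//|/negP]; rewrite -leNgt => H; rewrite !max_r; lra.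
Qed.

(** The distribution function is minus the right derivative of the excess:
    let e tend to 0 in [excess_slope]. *)
Lemma eq_distribution_of_excess f g : L1_on a f -> L1_on a g ->
  (forall s, 0 <= s -> excess a f s = excess a g s) ->
  (forall s, 0 <= s -> dist f s = dist g s).
Proof.
have le f' g' : L1_on a f' -> L1_on a g' ->
    (forall s, 0 <= s -> excess a f' s = excess a g' s) ->
    (forall s, 0 <= s -> (dist f' s <= dist g' s)%E).
  move=> f1 g1 fg s s0.
  have mf := measurable_L1 f1; have mg := measurable_L1 g1.
  apply: distribution_right_continuous => // e e0.
  have /andP[lf _] := excess_slope s f1 e0.
  have /andP[_ lg] := excess_slope s g1 e0.
  rewrite -[leLHS]fineK ?distribution_fin_num//.
  rewrite -[leRHS]fineK ?distribution_fin_num// lee_fin.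
  rewrite -(ler_pM2l e0); apply: le_trans lf _.
  by rewrite fg// fg// addr_ge0// ltW.
move=> f1 g1 fg s s0; apply/eqP; rewrite eq_le !le// => r r0.
by rewrite fg.
Qed.

Lemma ae_eq_excess f g s : L1_on a f -> L1_on a g -> ae_eq_on a f g ->
  excess a f s = excess a g s.
Proof.
move=> f1 g1 fg; have mf := measurable_L1 f1; have mg := measurable_L1 g1.
rewrite /excess /Rintegral; congr fine; apply: ae_eq_integral => //.
- exact: measurable_int (L1_on_pospart a0 s f1).
- exact: measurable_int (L1_on_pospart a0 s g1).
- by apply: ae_mono fg => x fgx /fgx /= ->.
Qed.

Lemma eq_excess_of_distribution f g s : L1_on a f -> L1_on a g -> 0 <= s ->
  (forall r, 0 <= r -> dist f r = dist g r) -> excess a f s = excess a g s.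
Proof.
move=> f1 g1 s0 fg; have mf := measurable_L1 f1; have mg := measurable_L1 g1.
apply: EFin_inj; rewrite !excessE//.
apply: eq_integral_pospart => //; try
  by apply: measurable_funB => //; exact: measurableT_comp.
move=> u u0; transitivity (dist f (u + s)).
  by congr (mu _); apply/seteqP; split => x /=; rewrite ltrBrDr.
rewrite fg ?addr_ge0//.
by congr (mu _); apply/seteqP; split => x /=; rewrite ltrBrDr.
Qed.

Lemma eq_mu_fun f g :
  (forall s, 0 <= s -> dist f s = dist g s) -> mu_fun a f = mu_fun a g.
Proof.
move=> fg; apply/funext => t; rewrite /mu_fun /rearrangement.
congr (fine (ereal_inf _)).
by apply/seteqP; split => _ [s [s0 /= ds] <-]; exists s => //; split => //=;
  rewrite ?fg// -?fg// ltW.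
Qed.

Lemma measurable_mu_fun_D f : L1_on a f -> measurable_fun D (mu_fun a f).
Proof.
move=> f1; apply/measurable_fun_itv_obnd_cbndP.
apply: measurable_funS (measurable_mu_fun a0 f1) => //.
by move=> x /=; rewrite !in_itv /= andbT => /andP[].
Qed.

(** The level set of the rearrangement is the interval from 0 to the
    distribution of [f] at s, the endpoint 0 being possibly excluded. *)
Lemma distribution_mu_fun f s : L1_on a f -> 0 <= s ->
  dist (mu_fun a f) s = dist f s.
Proof.
move=> f1 s0; have mf := measurable_L1 f1.
have d0 : 0 <= fine (dist f s) by rewrite fine_ge0// distribution_ge0.
have da : fine (dist f s) <= a.
  by rewrite -lee_fin fineK ?distribution_fin_num// distribution_le_length.
have mS : measurable [set t | D t /\ s < `|mu_fun a f t|].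
  by apply: measurable_level; exact: measurable_mu_fun_D.
apply/eqP; rewrite eq_le; apply/andP; split.
  apply: (@le_trans _ _ (mu `[0, fine (dist f s)]%classic)).
    apply: le_measure; rewrite ?inE//.
    move=> t /= []; rewrite !in_itv /= => /andP[+ _].
    rewrite le_eqVlt => /predU1P[<- _|t0].
      by rewrite eqxx.
    rewrite ger0_norm ?mu_fun_ge0// gt_mu_fun// => /ltW.
    by rewrite t0 orbT -lee_fin fineK ?distribution_fin_num.
  rewrite lebesgue_measure_itv /= lte_fin oppr0 adde0.
  by case: ifPn; rewrite ?distribution_ge0// fineK// distribution_fin_num.
apply: (@le_trans _ _ (mu `]0, fine (dist f s)[%classic)).
  rewrite lebesgue_measure_itv /= lte_fin oppr0 adde0.
  rewrite -[leLHS]fineK ?distribution_fin_num//.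
  by move: d0; rewrite le_eqVlt => /predU1P[<-|->]; rewrite ?ltxx.
apply: le_measure; rewrite ?inE//.
move=> t /=; rewrite !in_itv /= => /andP[t0 td].
rewrite (ltW t0) (lt_le_trans td)//; split => //.
rewrite ger0_norm ?mu_fun_ge0// gt_mu_fun//.
by rewrite -[ltRHS]fineK ?distribution_fin_num.
Qed.

Lemma L1_pos_mu_fun f : L1_on a f -> L1_pos a (mu_fun a f).
Proof.
move=> f1; have mf := measurable_L1 f1; have mm := measurable_mu_fun_D f1.
split; last by apply: aeW => x _; exact: mu_fun_ge0.
apply/integrableP; split; first exact/measurable_EFinP.
have /integrableP[_] := f1; apply: le_lt_trans.
rewrite le_eqVlt; apply/orP; left; apply/eqP.
transitivity (\int[mu]_(x in D) (Num.max `|mu_fun a f x| 0)%:E)%E.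
  by apply: eq_integral => x _; rewrite max_l.
transitivity (\int[mu]_(x in D) (Num.max `|f x| 0)%:E)%E; last first.
  by apply: eq_integral => x _; rewrite max_l.
apply: eq_integral_pospart => //; try exact: measurableT_comp.
move=> u u0; exact: distribution_mu_fun.
Qed.

Lemma ae_eq_mu_funP f g : L1_on a f -> L1_on a g ->
  ae_eq_on a (mu_fun a f) (mu_fun a g) <->
  (forall s, 0 <= s -> excess a f s = excess a g s).
Proof.
move=> f1 g1; split => [fg s s0|fg]; last first.
  by rewrite (eq_mu_fun (eq_distribution_of_excess f1 g1 fg)); exact: aeW.
have [mf1 _] := L1_pos_mu_fun f1; have [mg1 _] := L1_pos_mu_fun g1.
transitivity (excess a (mu_fun a f) s).
  by apply: eq_excess_of_distribution => // r r0; rewrite distribution_mu_fun.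
rewrite (ae_eq_excess _ mf1 mg1 fg).
by apply: eq_excess_of_distribution => // r r0; rewrite distribution_mu_fun.
Qed.

Lemma mu_fun_idem f : L1_on a f -> mu_fun a (mu_fun a f) = mu_fun a f.
Proof. by move=> f1; apply: eq_mu_fun => s s0; exact: distribution_mu_fun. Qed.

Lemma orbitP g f : L1_on a g -> orbit' a g f <->
  [/\ L1_pos a f, forall s, 0 <= s -> excess a f s <= excess a g s &
      excess a f 0 = excess a g 0].
Proof.
move=> g1; split => -[fp].
  have [f1 _] := fp; rewrite !L1_normE// => /submajorizedP H [fg].
  by split => //; apply: H.
have [f1 _] := fp => H E.
split; [exact: fp|exact: (submajorizedP a0 f1 g1).2|by rewrite !L1_normE// E].
Qed.

End orbit.

(** * Functions with the excess of g are extreme *)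

Section average.
Context {R : realType} (n : nat).
Implicit Types (v : 'I_n.+1 -> R) (s : R).
Local Notation avg v := (n.+1%:R^-1 * \sum_(i < n.+1) v i).

Lemma avgB v s : avg v - s = avg (fun i => v i - s).
Proof.
rewrite sumrB mulrBr; congr (_ - _).
rewrite sumr_const card_ord -[s *+ _]mulr_natr mulrCA.
by rewrite mulVf ?mulr1// pnatr_eq0.
Qed.

Lemma pospart_avg_le v s :
  Num.max (avg v - s) 0 <= avg (fun i => Num.max (v i - s) 0).
Proof.
rewrite avgB ge_max ler_pM2l ?invr_gt0 ?ltr0n// ler_sum/=; last first.
  by move=> i _; rewrite le_max lexx.
by rewrite mulr_ge0 ?invr_ge0// sumr_ge0// => i _; rewrite le_max lexx orbT.
Qed.

(** If two entries differ, a rational q strictly between them is a kink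
    of (v - q)^+ lying inside the range of [v], where Jensen's inequality
    is strict. *)
Lemma avg_pospart_eq_const v : (forall i, 0 <= v i) ->
  (forall q : rat, 0 <= q ->
     Num.max (avg v - ratr q) 0 = avg (fun i => Num.max (v i - ratr q) 0)) ->
  forall i j, v i = v j.
Proof.
move=> v0 H.
suff le i j : v j <= v i by move=> i j; apply/eqP; rewrite eq_le !le.
rewrite leNgt; apply/negP => /rat_in_itvoo[q].
rewrite in_itv /= => /andP[iq qj].
have /H : 0 <= q by rewrite -(ler0q R) ltW// (le_lt_trans _ iq).
have n0 : n.+1%:R^-1 != 0 :> R by rewrite invr_eq0 pnatr_eq0.
case: (leP (avg v - ratr q) 0) => _ /eqP.
  rewrite eq_sym mulf_eq0 (negbTE n0) /= => /eqP.
  move/psumr_eq0P => /(_ _ j isT); rewrite max_l ?subr_ge0 ?(ltW qj)//.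
  move=> E; suff : v j - ratr q = 0 by lra.
  by apply: E => l _; rewrite le_max lexx orbT.
rewrite avgB eq_sym -subr_eq0 -mulrBr mulf_eq0 (negbTE n0) /= -sumrB => /eqP.
move/psumr_eq0P => /(_ _ i isT); rewrite max_r ?subr_le0 ?(ltW iq)//.
move=> E; suff : 0 - (v i - ratr q) = 0 by lra.
by apply: E => l _; rewrite subr_ge0 le_max lexx.
Qed.

End average.

Section extreme.
Context {R : realType}.
Variable a : R.
Hypothesis a0 : 0 < a.
Implicit Types (f g : R -> R) (s t r e u : R).
Local Notation mu := (@lebesgue_measure R).
Local Notation D := (`[0, a[%classic : set R).

Lemma Rintegral_sum_D n (F : 'I_n -> R -> R) : (forall i, L1_on a (F i)) ->
  \int[mu]_(x in D) (\sum_(i < n) F i x) = \sum_(i < n) \int[mu]_(x in D) F i x.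
Proof.
elim: n F => [|n IH] F F1.
  rewrite big_ord0 -[RHS](mul0r (fine (mu D))) -Rintegral_cst//.
  by apply: eq_Rintegral => x _; rewrite big_ord0.
rewrite big_ord_recl -IH//.
rewrite -RintegralD//;
  first by apply: eq_Rintegral => x _; rewrite big_ord_recl.
- exact: F1.
- by apply: L1_on_sum.
Qed.

Lemma ae_zero_of_Rintegral_le0 f : L1_on a f -> ae_nonneg_on a f ->
  \int[mu]_(x in D) f x <= 0 -> ae_eq_on a f (fun=> 0).
Proof.
move=> f1 f0 le0; have mf := measurable_int _ f1.
have Efn : (\int[mu]_(x in D) (EFin \o f) x =
    \int[mu]_(x in D) `|(EFin \o f) x|)%E.
  apply: ae_eq_integral => //; first exact: measurableT_comp.
  by apply: ae_mono f0 => x fx0 Dx /=; rewrite ger0_norm// fx0.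
have : (\int[mu]_(x in D) `|(EFin \o f) x| = 0)%E.
  apply/eqP; rewrite eq_le integral_ge0// andbT -Efn.
  by rewrite -[leLHS]fineK ?lee_fin//; exact: integrable_fin_num.
move=> /(ae_eq_integral_abs mu (measurable_itv _) mf).1.
by apply: ae_mono => x fx /fx /= -[].
Qed.

(** For each s the average of the (|F i| - s)^+ dominates (|f| - s)^+ pointwise
    while its integral is at most that of (|f| - s)^+, so the two agree almost
    everywhere. Only countably many s are needed, which makes the null
    set uniform. *)
Lemma average_ae_const n f (F : 'I_n.+1 -> R -> R) :
  L1_pos a f -> (forall i, L1_pos a (F i)) ->
  (forall i s, 0 <= s -> excess a (F i) s <= excess a f s) ->
  ae_eq_on a f (fun x => n.+1%:R^-1 * \sum_(i < n.+1) F i x) ->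
  forall i j, ae_eq_on a (F i) (F j).
Proof.
move=> [f1 f0] Fp Ff fF.
have F1 i : L1_on a (F i) by have [] := Fp i.
have F0 : {ae mu, forall x, forall i, D x -> 0 <= F i x}.
  by apply: ae_forall_countType => i; have [] := Fp i.
have nfF : {ae mu, forall x, D x ->
    `|f x| = n.+1%:R^-1 * \sum_(i < n.+1) `|F i x|}.
  apply: ae_mono2 fF F0 => x fx Fx Dx.
  rewrite fx// ger0_norm; last first.
    by rewrite mulr_ge0 ?invr_ge0// sumr_ge0// => i _; exact: Fx.
  by congr (_ * _); apply: eq_bigr => i _; rewrite ger0_norm// Fx.
have E (q : rat) : {ae mu, forall x, 0 <= q -> D x ->
    Num.max (`|f x| - ratr q) 0 =
    n.+1%:R^-1 * \sum_(i < n.+1) Num.max (`|F i x| - ratr q) 0}.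
  have [q0|_] := leP 0 q; last by apply: aeW.
  have r0 : 0 <= ratr q :> R by rewrite ler0q.
  have sF1 : L1_on a (fun x => \sum_(i < n.+1) Num.max (`|F i x| - ratr q) 0).
    by apply: L1_on_sum => // i; exact: L1_on_pospart.
  have aF1 := L1_onZ n.+1%:R^-1 sF1.
  have G1 := L1_onB aF1 (L1_on_pospart a0 (ratr q) f1).
  suff : ae_eq_on a (fun x => n.+1%:R^-1 *
      (\sum_(i < n.+1) Num.max (`|F i x| - ratr q) 0) -
      Num.max (`|f x| - ratr q) 0) (fun=> 0).
    by apply: ae_mono => x Gx _ /Gx /eqP; rewrite subr_eq0 => /eqP.
  apply: ae_zero_of_Rintegral_le0 => //.
    apply: ae_mono nfF => x fx Dx; rewrite subr_ge0 fx//.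
    exact: (pospart_avg_le (fun i => `|F i x|)).
  rewrite RintegralB// ?RintegralZl// ?Rintegral_sum_D//.
  - rewrite subr_le0 ler_pdivrMl ?ltr0n//.
    rewrite mulrC mulr_natr -[X in _ *+ X]card_ord -sumr_const.
    by apply: ler_sum => i _; exact: Ff.
  - by move=> i; exact: L1_on_pospart.
  - exact: L1_on_pospart.
have {}E := ae_forall_countType E.
have {}E : {ae mu, forall x, forall i j, D x -> F i x = F j x}.
  apply: ae_mono2 (ae_mono2 (fun x => @conj _ _) E F0) nfF.
  move=> x [Ex Fx] nx i j Dx.
  rewrite -[LHS]ger0_norm ?Fx// -[RHS]ger0_norm ?Fx//.
  apply: (@avg_pospart_eq_const _ _ (fun i => `|F i x|)) => // q q0.
  by rewrite -nx// Ex.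
by move=> i j; apply: ae_mono E => x Ex; exact: Ex.
Qed.

Lemma k_extreme_of_eq_excess k g f : (0 < k)%N -> L1_on a g -> L1_pos a f ->
  (forall s, 0 <= s -> excess a f s = excess a g s) ->
  k_extreme a k (orbit' a g) f.
Proof.
move=> k0 g1 fp fg; split.
  by apply/orbitP => //; split => // [s s0|]; rewrite fg.
move=> F Fo fF.
have Fp i : L1_pos a (F i) by have /(orbitP a0 _ g1)[] := Fo i.
have FF := average_ae_const fp Fp _ fF.
pose i0 : 'I_k.+1 := ord0; pose i1 : 'I_k.+1 := Ordinal (k0 : (1 < k.+1)%N).
(* the relation F i0 - F i1 = 0, which uses k >= 1 *)
exists (fun i => (i == i0)%:R - (i == i1)%:R); split.
  by exists i0; rewrite eqxx subr0 oner_eq0.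
have : ae_eq_on a (F i0) (F i1).
  apply: FF => i s s0; rewrite fg//.
  by have /(orbitP a0 _ g1)[_ + _] := Fo i; exact.
apply: ae_mono => x Fx /Fx E.
under eq_bigr do rewrite mulrBl.
rewrite sumrB (bigD1 i0)// eqxx mul1r big1 ?addr0; last first.
  by move=> i /negbTE ->; rewrite mul0r.
rewrite (bigD1 i1)// eqxx mul1r big1 ?addr0 ?E ?subrr//.
by move=> i /negbTE ->; rewrite mul0r.
Qed.

End extreme.

(** * A level with slack that is charged by f *)

Lemma lipschitz_nonincr_continuous (R : realType) (K : R) (f : R -> R) :
  (forall s t, s <= t -> f t <= f s <= f t + K * (t - s)) -> continuous f.
Proof.
move=> H x; apply/cvgrPdist_lt => e e0.
have K0 : 0 <= K.
  by have /andP[] := H 0 1 ler01; lra.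
have K10 : 0 < K + 1 by lra.
near=> y.
have dy : `|x - y| < e / (K + 1).
  by near: y; apply: cvgr_dist_lt; rewrite ?divr_gt0.
have : `|f x - f y| <= K * `|x - y|.
  have [xy|/ltW yx] := leP x y.
    have /andP[l1 l2] := H _ _ xy.
    by rewrite (distrC x) !ger0_norm; lra.
  have /andP[l1 l2] := H _ _ yx.
  by rewrite (distrC (f x)) !ger0_norm; lra.
move=> /le_lt_trans; apply.
apply: (@le_lt_trans _ _ ((K + 1) * `|x - y|)).
  by rewrite ler_wpM2r//; lra.
by rewrite mulrC -ltr_pdivlMr.
Unshelve. all: by end_near. Qed.

Section level.
Context {R : realType}.
Variable a : R.
Hypothesis a0 : 0 < a.
Implicit Types (f g : R -> R) (s t r e u : R).
Local Notation mu := (@lebesgue_measure R).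
Local Notation D := (`[0, a[%classic : set R).
Local Notation dist f s := (distribution_function a s f).
Local Notation excess := (excess a).

Lemma excess_lipschitz f s t : L1_on a f -> s <= t ->
  excess f t <= excess f s <= excess f t + a * (t - s).
Proof.
move=> f1; rewrite le_eqVlt => /predU1P[->|st].
  by rewrite subrr mulr0 addr0 lexx.
have mf := measurable_L1 f1.
have st0 : 0 < t - s by rewrite subr_gt0.
have /andP[] := excess_slope a0 s f1 st0; rewrite subrKC => l1 l2.
have d0 : 0 <= (t - s) * fine (dist f t).
  by rewrite mulr_ge0 ?fine_ge0 ?distribution_ge0// ltW.
have da : (t - s) * fine (dist f s) <= (t - s) * a.
  rewrite ler_pM2l// -lee_fin fineK ?distribution_fin_num//.
  exact: distribution_le_length.
by apply/andP; split; lra.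
Qed.

Lemma excess_midpoint_convex f s e : L1_on a f -> 0 < e ->
  2 * excess f s <= excess f (s - e) + excess f (s + e).
Proof.
move=> f1 e0.
have /andP[l1 _] := excess_slope a0 (s - e) f1 e0.
have /andP[_ l2] := excess_slope a0 s f1 e0.
by move: l1; rewrite subrK; lra.
Qed.

(** Equal distributions at s - e and s + e mean that |f| has no value between
    them, up to a null set; the excess is then affine there. *)
Lemma excess_midpoint_affine f s e : L1_on a f -> 0 < e ->
  dist f (s - e) = dist f (s + e) ->
  excess f (s - e) + excess f (s + e) <= 2 * excess f s.
Proof.
move=> f1 e0 d.
have /andP[_ l1] := excess_slope a0 (s - e) f1 e0.
have /andP[l2 _] := excess_slope a0 s f1 e0.
by move: l1; rewrite subrK d; lra.
Qed.

Lemma excess_small f e : L1_on a f -> 0 < e ->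
  exists2 s0, 0 <= s0 & forall s, s0 <= s -> excess f s < e.
Proof.
move=> f1 e0; have mf := measurable_L1 f1.
pose F (n : nat) x := (Num.max (`|f x| - n%:R) 0)%:E.
have mF n : measurable_fun D (F n).
  exact: measurable_int (L1_on_pospart a0 n%:R f1).
have [] := @dominated_convergence _ _ R mu D (measurable_itv _) F (cst 0%E)
  (fun x => `|f x|%:E) mF (measurable_cst _).
- apply: aeW => x Dx; apply: cvg_near_cst.
  near=> n; rewrite /F max_r// subr_le0; near: n; exact: nbhs_infty_ger.
- exact: L1_on_norm.
- apply: aeW => x Dx n; rewrite /F /= lee_fin ger0_norm ?le_max ?lexx ?orbT//.
  by rewrite ge_max normr_ge0 andbT lerBlDr lerDl.
move=> _ _; rewrite integral0 => cv.
have : \forall n \near \oo, (excess f n%:R < e).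
  have /fine_cvg : (\int[mu]_(x in D) F n x)%E @[n --> \oo] --> 0%:E by [].
  by move/cvgr_lt => /(_ _ e0).
move=> [N _ /(_ N (leqnn N)) HN]; exists N%:R => // s Ns.
by have /andP[/le_lt_trans->] := excess_lipschitz f1 Ns.
Unshelve. all: by end_near. Qed.

(** The last inequality is the slack that absorbs a perturbation of size [e]
    on a domain of length [a], and the strict one says that |f| has values
    in (c - e, c + e] on a set of positive measure. *)
Lemma exists_slack_level f g s0 : L1_on a f -> L1_on a g ->
  excess f 0 = excess g 0 -> 0 <= s0 -> excess f s0 < excess g s0 ->
  exists c e, [/\ 0 < e, 2 * e <= c, (dist f (c + e) < dist f (c - e))%E &
    forall s, c - 2 * e <= s -> s <= c + 2 * e ->
      excess f s + e * a <= excess g s].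
Proof.
move=> f1 g1 fg0 s00 fgs0.
pose d s := excess g s - excess f s.
have ds0 : 0 < d s0 by rewrite subr_gt0.
have d20 : 0 < d s0 / 2 by rewrite divr_gt0.
have [M' M'0 HM'] := excess_small g1 d20.
pose M := Num.max M' (s0 + 1).
have M0 : 0 < M by rewrite lt_max; apply/orP; right; lra.
have s0M : s0 < M by rewrite lt_max; apply/orP; right; lra.
have dM : d M < d s0 / 2.
  have : excess g M < d s0 / 2 by apply: HM'; rewrite le_max lexx.
  by have := excess_ge0 a f M; rewrite /d; lra.
(* [eta] is so small that the maximum of the bent difference H is neither at 0
   nor at M *)
pose eta := d s0 / 4 / M ^+ 2.
have eta0 : 0 < eta by rewrite !divr_gt0// exprn_gt0.
have etaM : eta * M ^+ 2 = d s0 / 4 by rewrite mulfVK// gt_eqF// exprn_gt0.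
pose H s := d s + eta * s ^+ 2.
have cH : continuous H.
  move=> x; apply: cvgD; first apply: cvgB.
  - exact: (lipschitz_nonincr_continuous
      (fun s t => @excess_lipschitz g s t g1)).
  - exact: (lipschitz_nonincr_continuous
      (fun s t => @excess_lipschitz f s t f1)).
  - by apply: cvgM; [exact: cvg_cst|exact: exprn_continuous].
have [|c] := EVT_max (ltW M0) (f := H).
  exact: continuous_subspaceT.
rewrite in_itv /= => /andP[c0 cM] Hmax.
have HcH s : 0 <= s -> s <= M -> d s + eta * s ^+ 2 <= d c + eta * c ^+ 2.
  by move=> s1 s2; apply: (Hmax s); rewrite in_itv /= s1.
have Hs0 := HcH s0 s00 (ltW s0M).
have es0 : 0 <= eta * s0 ^+ 2 by rewrite mulr_ge0 ?exprn_ge0// ltW.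
have ec : eta * c ^+ 2 <= d s0 / 4.
  by rewrite -etaM ler_pM2l// lerXn2r// nnegrE// ltW.
have dc : 0 < d c by lra.
have {}c0 : 0 < c.
  rewrite lt_neqAle c0 andbT; apply/eqP => c00.
  by move: dc; rewrite -c00 /d fg0 subrr ltxx.
have {}cM : c < M.
  rewrite lt_neqAle cM andbT; apply/eqP => cMM.
  by move: Hs0; rewrite cMM etaM; lra.
pose e := Num.min (Num.min (c / 2) (M - c)) (d c / (3 * a)).
have e0 : 0 < e.
  by rewrite !lt_min subr_gt0 cM !divr_gt0// mulr_gt0.
have [e1 e2 e3] : [/\ e <= c / 2, e <= M - c & e <= d c / (3 * a)].
  by split; rewrite !ge_min lexx ?orbT.
have [ce0 ceM] : 0 <= c - e /\ c - e <= M by clear -e0 e1 c0 cM; split; lra.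
have [ce'0 ce'M] : 0 <= c + e /\ c + e <= M by clear -e0 e2 c0 cM; split; lra.
have e3' : 3 * (a * e) <= d c.
  by move: e3; rewrite ler_pdivlMr ?mulr_gt0//; lra.
exists c, e; split => //; first lra.
  have mf := measurable_L1 f1.
  rewrite lt_neqAle distribution_nonincreasing// ?andbT; last lra.
  apply/eqP => dE.
  (* in this case the difference d is midpoint convex at c, H even strictly,
     which excludes a maximum *)
  have L1 := excess_midpoint_affine f1 e0 (esym dE).
  have L2 := excess_midpoint_convex c g1 e0.
  have Hm := HcH _ ce0 ceM.
  have Hp := HcH _ ce'0 ce'M.
  have : 0 < eta * e ^+ 2 by rewrite mulr_gt0// exprn_gt0.
  by move: L1 L2 Hm Hp; rewrite /d !sqrrD sqrrN !mulrDr; lra.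
move=> s s1 s2.
suff : d c - 2 * (a * e) <= d s by rewrite /d; move: e3'; rewrite /d; lra.
have [cs|/ltW sc] := leP c s.
  have /andP[g1' g2'] := excess_lipschitz g1 cs.
  have /andP[f1' f2'] := excess_lipschitz f1 cs.
  have : a * (s - c) <= 2 * (a * e) by rewrite mulrCA ler_pM2l//; lra.
  by rewrite /d; lra.
have /andP[g1' g2'] := excess_lipschitz g1 sc.
have /andP[f1' f2'] := excess_lipschitz f1 sc.
have : a * (c - s) <= 2 * (a * e) by rewrite mulrCA ler_pM2l//; lra.
by rewrite /d; lra.
Qed.

End level.

(** * Splitting a set into pieces of equal measure *)

Section splitting.
Context {R : realType}.
Variable a : R.
Hypothesis a0 : 0 < a.
Local Notation mu := (@lebesgue_measure R).
Local Notation D := (`[0, a[%classic : set R).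

(** The measure of E below x is a continuous function of x; cut E at
    the points where it reaches the multiples of 1 / (n + 1) of its
    final value. The pieces are indexed by [nat] to let consecutive cutting
    points be addressed without casts. *)
Lemma exists_equal_pieces n (E : set R) : measurable E -> E `<=` D ->
    0 < fine (mu E) ->
  exists A : nat -> set R,
    [/\ forall i, (i < n.+1)%N -> measurable (A i),
        forall i, (i < n.+1)%N -> A i `<=` E,
        forall i, (i < n.+1)%N -> fine (mu (A i)) = fine (mu E) / n.+1%:R &
        forall i j x, (i < n.+1)%N -> (j < n.+1)%N -> A i x -> A j x -> i = j].
Proof.
move=> mE ED m0.
have mEx (x y : R) : measurable (E `&` `[x, y[) by exact: measurableI.
have mufin (B : set R) : measurable B -> B `<=` D -> mu B \is a fin_num.
  move=> mB BD; rewrite ge0_fin_numE//.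
  apply: (@le_lt_trans _ _ (mu D)); last by rewrite measure_domain// ltry.
  by apply: le_measure; rewrite ?inE.
have finE (x y : R) : mu (E `&` `[x, y[) \is a fin_num.
  by apply: mufin => //; apply: subset_trans ED; exact: subIsetl.
pose G (x : R) := fine (mu (E `&` `[0, x[)).
have Gadd (x y : R) : 0 <= x -> x <= y ->
    G y = G x + fine (mu (E `&` `[x, y[)).
  move=> x0 xy; rewrite /G -fineD// -measureU; [|exact: mEx|exact: mEx|].
    congr (fine (mu _)); rewrite -setIUr; congr (_ `&` _).
    apply/seteqP; split => z /=; rewrite !in_itv /=.
      by move=> /andP[z0 zy]; case: (ltP z x) => zx; [left|right];
        rewrite ?z0 ?zx.
    by case=> /andP[z1 z2]; rewrite ?z1 ?z2 ?(lt_le_trans z2)// (le_trans x0).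
  apply/seteqP; split => z //= [[_ +] [_ +]].
  rewrite !in_itv /= => /andP[_ zx] /andP[xz _].
  by move: (lt_le_trans zx xz); rewrite ltxx.
have Gle (x y : R) : 0 <= x -> x <= y -> G x <= G y <= G x + (y - x).
  move=> x0 xy; rewrite (Gadd x y)// lerDl fine_ge0//= lerD2l -lee_fin fineK//.
  apply: (@le_trans _ _ (mu `[x, y[%classic)).
    apply: le_measure; rewrite ?inE; [exact: mEx|exact: measurable_itv|].
    exact: subIsetr.
  rewrite lebesgue_measure_itv /= lte_fin; case: ifPn => //.
  by rewrite lee_fin subr_ge0.
have G0 : G 0 = 0.
  rewrite /G (_ : `[0, 0[%classic = set0) ?setI0 ?measure0//.
  apply/seteqP; split => x //=; rewrite in_itv /=.
  by move=> /andP[/le_lt_trans h /h]; rewrite ltxx.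
have Ga : G a = fine (mu E) by rewrite /G setIidl.
(* extended by a constant to the left of 0, G is 1-Lipschitz on the line *)
pose H x := G (Num.max x 0).
have H0 : H 0 = 0 by rewrite /H max_l.
have Ha : H a = fine (mu E) by rewrite /H max_l// ltW.
have cH : continuous H.
  suff h : continuous (fun x => - H x).
    have -> : H = (fun x => - (- H x)) by apply/funext => y; rewrite opprK.
    by move=> x; exact: (cvgN (h x)).
  apply: (@lipschitz_nonincr_continuous _ 1) => s t st.
  have /andP[h1 h2] : G (Num.max s 0) <= G (Num.max t 0) <=
      G (Num.max s 0) + (Num.max t 0 - Num.max s 0).
    apply: Gle; first by rewrite le_max lexx orbT.
    by rewrite ge_max !le_max lexx st !orbT.
  have : Num.max t 0 - Num.max s 0 <= t - s.
    by rewrite !maxEle; case: (leP t 0); case: (leP s 0); lra.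
  by rewrite /H; move=> h3; apply/andP; split; lra.
pose v (i : nat) : R := i%:R * (fine (mu E) / n.+1%:R).
have vS i : v i.+1 = v i + fine (mu E) / n.+1%:R.
  by rewrite /v -addn1 natrD mulrDl mul1r.
have w0 : 0 < fine (mu E) / n.+1%:R by rewrite divr_gt0.
have /choice[x xP] : forall i : nat, exists x, (i <= n.+1)%N ->
    [/\ 0 <= x, x <= a & G x = v i].
  move=> i; have [ile|//] := leqP i n.+1; last by exists 0.
  have [| |x] := @IVT _ H 0 a (v i) (ltW a0).
  - exact: continuous_subspaceT.
  - rewrite H0 Ha min_l ?(ltW m0)// max_r ?(ltW m0)// /v mulr_ge0 ?(ltW w0)//=.
    rewrite mulrCA ler_piMr ?(ltW m0)// ler_pdivrMr ?ltr0n// mul1r ler_nat//.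
  rewrite in_itv /= => /andP[x0 xa]; rewrite /H max_l// => Gx.
  by exists x => _; split.
have xle i j : (i <= j)%N -> (j <= n.+1)%N -> x i <= x j.
  rewrite leq_eqVlt => /predU1P[->//|ij jn]; rewrite leNgt; apply/negP => xji.
  have [_ _ Gi] := xP i (leq_trans (ltnW ij) jn).
  have [xj0 _ Gj] := xP j jn.
  have /andP[+ _] := Gle _ _ xj0 (ltW xji).
  by rewrite Gi Gj /v ler_pM2r// ler_nat leqNgt ij.
exists (fun i => E `&` `[x i, x i.+1[).
split => [i _|i _ z []//|i ilt|i j z ilt jlt].
- exact: mEx.
- have [xi0 _ Gi] := xP i (ltnW ilt).
  have [_ _ Gi1] := xP i.+1 ilt.
  have := Gadd _ _ xi0 (xle i i.+1 (leqnSn i) ilt).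
  by rewrite Gi Gi1 vS => /addrI.
- wlog ij : i j ilt jlt / (i <= j)%N.
    move=> H' iz jz; have [ij|ij] := leqP i j; first exact: H'.
    by apply/esym; apply: H' => //; exact: ltnW.
  move=> [_ iz] [_ jz]; apply/eqP; rewrite eqn_leq ij/= leqNgt.
  apply/negP => ij'.
  move: iz jz; rewrite /= !in_itv /= => /andP[_ zi] /andP[jz _].
  have := xle i.+1 j ij' (ltnW jlt).
  by move=> /(lt_le_trans zi)/lt_le_trans => /(_ _ jz); rewrite ltxx.
Qed.
End splitting.

(** * Functions with smaller excess are not extreme *)

Section perturbation.
Context {R : realType}.
Variable a : R.
Hypothesis a0 : 0 < a.
Implicit Types (f g : R -> R) (s t r e u : R).
Local Notation mu := (@lebesgue_measure R).
Local Notation D := (`[0, a[%classic : set R).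
Local Notation dist f s := (distribution_function a s f).
Local Notation excess := (excess a).

(** Where [h] acts, both |f| and |f| + h lie within 2e of c. At levels below
    this window the truncation is linear, so [h] contributes its zero
    integral; above it the truncation vanishes; inside it the excess
    grows by at most e times a, which is the available slack. *)
Lemma excess_perturbation f g h c e : L1_on a f -> L1_on a h ->
  0 < e -> 2 * e <= c ->
  (forall s, 0 <= s -> excess f s <= excess g s) ->
  (forall s, c - 2 * e <= s -> s <= c + 2 * e ->
    excess f s + e * a <= excess g s) ->
  (forall x, `|h x| <= e) ->
  (forall x, D x -> h x != 0 -> c - e < `|f x| /\ `|f x| <= c + e) ->
  \int[mu]_(x in D) h x = 0 ->
  forall s, 0 <= s -> excess (fun x => `|f x| + h x) s <= excess g s.
Proof.
move=> f1 h1 e0 ec fg fge he hE h0 s s0.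
have F1 := L1_onD (L1_on_norm f1) h1.
have nF x : D x -> `| `|f x| + h x| = `|f x| + h x.
  move=> Dx; apply: ger0_norm.
  have [->|/hE] := eqVneq (h x) 0; first by rewrite addr0.
  by move=> /(_ Dx)[fc _]; have := he x; rewrite ler_norml; lra.
have [s1|s1] := ltP s (c - 2 * e).
  apply: le_trans (fg s s0); rewrite le_eqVlt; apply/orP; left; apply/eqP.
  rewrite -[RHS]addr0 -h0 /excess -RintegralD//; last exact: L1_on_pospart.
  apply: eq_Rintegral => x; rewrite inE => Dx; rewrite nF//.
  have [->|/hE] := eqVneq (h x) 0; first by rewrite !addr0.
  move=> /(_ Dx)[fc _]; have := he x; rewrite ler_norml => /andP[hx _].
  by rewrite !max_l; lra.
have [s2|s2] := leP s (c + 2 * e).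
  apply: le_trans (fge s s1 s2).
  have -> : e * a = \int[mu]_(x in D) e.
    rewrite Rintegral_cst//; congr (_ * _).
    exact: (congr1 fine (esym (measure_domain a0))).
  rewrite /excess -RintegralD//; [|exact: L1_on_pospart|exact: L1_on_cst].
  apply: le_Rintegral => //; first exact: L1_on_pospart.
    by apply: L1_onD; [exact: L1_on_pospart|exact: L1_on_cst].
  move=> x Dx; rewrite nF//.
  have := he x; rewrite ler_norml => /andP[_ hx].
  have h2 : `|f x| - s <= Num.max (`|f x| - s) 0 by rewrite le_max lexx.
  have h3 : 0 <= Num.max (`|f x| - s) 0 by rewrite le_max lexx orbT.
  by rewrite ge_max; apply/andP; split; lra.
apply: le_trans (fg s s0); rewrite le_eqVlt; apply/orP; left; apply/eqP.
apply: eq_Rintegral => x; rewrite inE => Dx; rewrite nF//.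
have [->|/hE] := eqVneq (h x) 0; first by rewrite !addr0.
move=> /(_ Dx)[_ fc]; have := he x; rewrite ler_norml => /andP[_ hx].
by rewrite !max_r; lra.
Qed.

(** The perturbation number i is e times the indicator of the piece A i minus
    the mean S / (k + 1) of all indicators: integral and sum over i both
    vanish. In a linear relation with coefficients w, integrating gives
    that the w i add up to 0, because all the perturbed functions have
    the integral of f, which is positive; then |f| and S drop out and
    only the term e * w i is left on A i. *)
Lemma not_k_extreme k g f : L1_on a g -> orbit' a g f ->
  (exists2 s, 0 <= s & excess f s < excess g s) ->
  ~ k_extreme a k (orbit' a g) f.
Proof.
move=> g1 /(orbitP a0 _ g1)[[f1 f0] fg fg0] [s0 s00 fgs0].
have [c [e [e0 ec dE slack]]] := exists_slack_level a0 f1 g1 fg0 s00 fgs0.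
have mf := measurable_L1 f1.
pose E := [set x | D x /\ c - e < `|f x|] `\` [set x | D x /\ c + e < `|f x|].
have mL r : measurable [set x | D x /\ r < `|f x|] by exact: measurable_level.
have mE : measurable E by exact: measurableD.
have ED : E `<=` D by move=> x [[]].
have distE : dist f (c - e) = (mu E + dist f (c + e))%E.
  rewrite /distribution_function -measureU; [|exact: mE|exact: mL|].
    congr (mu _); apply/seteqP; split => x /=.
      move=> [Dx cx]; have [|] := ltP (c + e) `|f x|; [by right|left].
      by split => // -[_]; rewrite ltNge => /negP.
    by move=> [[]//|[Dx cx]]; split => //; lra.
  by apply/seteqP; split => x // [[_ +]].
have muE : 0 < fine (mu E).
  rewrite lt_neqAle fine_ge0// andbT; apply/eqP => E0; move: dE; rewrite distE.
  rewrite -[mu E]fineK -?E0 ?add0e ?ltxx// ge0_fin_numE//.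
  apply: (@le_lt_trans _ _ (mu D)); last by rewrite measure_domain// ltry.
  by apply: le_measure; rewrite ?inE.
have [A [mA AE muA Adisj]] := exists_equal_pieces a0 k mE ED muE.
set m := fine (mu E) / k.+1%:R in muA.
have m0 : 0 < m by rewrite divr_gt0.
pose I (i : 'I_k.+1) : R -> R := \1_(A i).
have k1 : k.+1%:R != 0 :> R by rewrite pnatr_eq0.
have I1 i : L1_on a (I i) by apply: L1_on_indic => //; exact: mA.
have I01 i x : 0 <= I i x <= 1.
  by rewrite /I indicE; case: (_ \in _); rewrite ?lexx ?ler01.
have intI i : \int[mu]_(x in D) I i x = m.
  rewrite /I Rintegral_indic_D ?muA//; first exact: mA.
  exact: subset_trans (AE i _) ED.
pose S x := \sum_j I j x.
have S1 : L1_on a S by exact: L1_on_sum.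
have intS : \int[mu]_(x in D) S x = m *+ k.+1.
  rewrite Rintegral_sum_D//; under eq_bigr do rewrite intI.
  by rewrite sumr_const card_ord.
pose h i x := e * (I i x - k.+1%:R^-1 * S x).
have h1 i : L1_on a (h i).
  by apply: L1_onZ; apply: L1_onB => //; exact: L1_onZ.
have h0 i : \int[mu]_(x in D) h i x = 0.
  rewrite RintegralZl//; last by apply: L1_onB => //; exact: L1_onZ.
  rewrite RintegralB; [|exact: measurable_itv|exact: I1|exact: L1_onZ].
  rewrite RintegralZl; [|exact: measurable_itv|exact: S1].
  rewrite intI intS -[m *+ _]mulr_natl mulrA mulVf//.
  by rewrite mul1r subrr mulr0.
have he i x : `|h i x| <= e.
  rewrite /h normrM gtr0_norm// ger_pMr// ler_norml.
  have /andP[i0 i1] := I01 i x.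
  have Sn : 0 <= k.+1%:R^-1 * S x <= 1.
    rewrite mulr_ge0 ?invr_ge0//=;
      last by apply: sumr_ge0 => j _; case/andP: (I01 j x).
    rewrite ler_pdivrMl ?ltr0n// mulr1 -[leRHS]/(1 *+ k.+1).
    rewrite -[in leRHS](card_ord k.+1) -sumr_const.
    by apply: ler_sum => j _; case/andP: (I01 j x).
  move: (_ * S x) (I i x) i0 i1 Sn => y z z0 z1 /andP[y0 y1].
  by apply/andP; split; lra.
have hE i x : D x -> h i x != 0 -> c - e < `|f x| /\ `|f x| <= c + e.
  move=> Dx hx; have : E x.
    apply: contrapT => nE; move/negP: hx; apply; apply/eqP.
    have I0 j : I j x = 0 by rewrite /I indicE memNset// => /(AE j (ltn_ord j)).
    by rewrite /h I0 /S big1 ?mulr0 ?subr0 ?mulr0.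
  by move=> [[_ ?] H]; split => //; rewrite leNgt; apply/negP => H'; apply: H.
have sumh x : \sum_i h i x = 0.
  rewrite /h -mulr_sumr sumrB sumr_const card_ord.
  rewrite -[_ *+ k.+1]mulr_natl mulrA divff//.
  by rewrite mul1r subrr mulr0.
pose F i x := `|f x| + h i x.
have F1 i : L1_on a (F i) := L1_onD (L1_on_norm f1) (h1 i).
have Fpos i x : D x -> 0 <= F i x.
  move=> Dx; rewrite /F.
  have [->|/hE] := eqVneq (h i x) 0; first by rewrite addr0.
  by move=> /(_ Dx)[fc _]; have := he i x; rewrite ler_norml; lra.
have intF i : \int[mu]_(x in D) F i x = excess f 0.
  rewrite RintegralD; [|exact: measurable_itv|exact: L1_on_norm|exact: h1].
  by rewrite h0 addr0; apply: eq_Rintegral => x _; rewrite subr0 max_l.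
have Fo i : orbit' a g (F i).
  apply/orbitP => //; split.
  - by split => //; apply: aeW => x; exact: Fpos.
  - by apply: (excess_perturbation f1 (h1 i) e0 ec) => //; exact: hE.
  - rewrite -fg0 -(intF i); apply: eq_Rintegral => x; rewrite inE => Dx.
    by rewrite subr0 max_l// ger0_norm// Fpos.
move=> [_ /(_ F Fo)] [].
  apply: ae_mono f0 => x fx Dx.
  rewrite /F big_split/= sumh addr0 sumr_const card_ord.
  rewrite -[`|f x| *+ _]mulr_natl mulrA mulVf//.
  by rewrite mul1r ger0_norm// fx.
move=> w [[i wi] wF].
have Fw1 : L1_on a (fun x => \sum_(i < k.+1) w i * F i x).
  by apply: L1_on_sum => // j; apply: L1_onZ; exact: F1.
have f00 : 0 < excess f 0.
  rewrite fg0; have /andP[+ _] := excess_lipschitz a0 g1 s00.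
  by apply: lt_le_trans; apply: le_lt_trans fgs0; exact: excess_ge0.
have W0 : \sum_j w j = 0.
  have : \int[mu]_(x in D) (\sum_(i < k.+1) w i * F i x) = 0.
    transitivity (\int[mu]_(x in D) (0 : R));
      last by rewrite Rintegral_cst// mul0r.
    rewrite /Rintegral; congr fine; apply: ae_eq_integral => //.
    - exact: measurable_int Fw1.
    - by apply: ae_mono wF => x wx /wx ->.
  rewrite Rintegral_sum_D//; last by move=> j; apply: L1_onZ; exact: F1.
  under eq_bigr => j _.
    rewrite RintegralZl; [|exact: measurable_itv|exact: F1].
    by rewrite intF over.
  by rewrite -mulr_suml => /eqP; rewrite mulf_eq0 (gt_eqF f00) orbF => /eqP.
have Ai0 : mu (A i) = 0.
  have [N [mN N0 AN]] : {ae mu, forall x, ~ A i x}.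
    apply: ae_mono wF => x wx Aix.
    have Dx : D x by apply: ED; exact: AE Aix.
    have : \sum_(j < k.+1) w j * F j x = e * w i.
      under eq_bigr do rewrite /F /h mulrDr mulrCA mulrBr mulrBr.
      rewrite big_split/= -mulr_suml W0 mul0r add0r.
      rewrite sumrB -!mulr_sumr -mulr_suml W0 mul0r mulr0 subr0.
      congr (_ * _); rewrite (bigD1 i)//= big1 ?addr0.
        by rewrite /I indicE mem_set ?mulr1.
      move=> j ji; rewrite /I indicE memNset ?mulr0// => Ajx.
      by move/negP: ji; apply; apply/eqP/val_inj; exact: (Adisj j i x).
    rewrite wx// => /esym/eqP; rewrite mulf_eq0 (gt_eqF e0)/=.
    exact/negP.
  apply/eqP; rewrite -measure_le0 -N0; apply: le_measure; rewrite ?inE.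
  - exact: mA.
  - exact: mN.
  - by move=> x Aix; apply: AN => /=; apply.
by move: m0; rewrite -(muA i (ltn_ord i)) Ai0 /= ltxx.
Qed.

End perturbation.

(** * The characterization *)

Lemma k_extremeP (R : realType) (a : R) (k : nat) (g f : R -> R) :
  0 < a -> (0 < k)%N -> L1_on a g ->
  k_extreme a k (orbit' a g) f <->
  L1_pos a f /\ ae_eq_on a (mu_fun a f) (mu_fun a g).
Proof.
move=> a0 k0 g1; split=> [fext|[fp fg]]; last first.
  have [f1 _] := fp.
  apply: k_extreme_of_eq_excess => //.
  exact: (ae_eq_mu_funP a0 f1 g1).1.
have [fo _] := fext; have [fp le_fg _] := (orbitP a0 f g1).1 fo.
have [f1 _] := fp; split => //.
apply: (ae_eq_mu_funP a0 f1 g1).2 => s s0.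
apply/eqP; rewrite eq_le le_fg//= leNgt; apply/negP => fgs.
by apply: (not_k_extreme a0 g1 fo) fext; exists s.
Qed.

Theorem proposition4p4 (R : realType) (a : R) (ha : 0 < a) (g : R -> R)
    (hg : L1_pos a g) (k : nat) (hk : (0 < k)%N) :
  (forall f : R -> R, L1_pos a f ->
     (k_extreme a k (orbit' a g) f <->
      k_extreme a k (orbit' a g) (mu_fun a f))) /\
  [set f | k_extreme a k (orbit' a g) f] =
  [set f | L1_pos a f /\ ae_eq_on a (mu_fun a f) (mu_fun a g)].
Proof.
have [g1 _] := hg.
split=> [f fp|]; last by apply/seteqP; split => f /= /(k_extremeP f ha hk g1).
have [f1 _] := fp.
split=> /(k_extremeP _ ha hk g1)[_ fg]; apply/(k_extremeP _ ha hk g1).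
  by split; [exact: L1_pos_mu_fun|rewrite mu_fun_idem].
by rewrite mu_fun_idem in fg.
Qed.
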